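(* The scheduling game on $2$ unrelated machines under the RANDOM policy is a potential game: for any $n$ jobs with arbitrary processing times $p_{i,j}>0$ ($1\le i\le n$, $j\in\{1,2\}$), starting from any strategy profile, every sequence of better-response moves is finite.
   Context: Scheduling game: each job is a player choosing one machine; a strategy profile is a map $\sigma:\{1,\dots,n\}\to\{1,2\}$; $p_{i,j}$ is the processing time of job $i$ on machine $j$ (unrelated machines: arbitrary values). Under the RANDOM policy (jobs on a machine are processed in uniformly random order, without preemption), the cost of job $i$ with $\sigma(i)=j$ is $c_i(\sigma)=p_{i,j}+\frac12\sum_{i'\neq i:\ \sigma(i')=j}p_{i',j}$. A better-response move is a change of machine by a single job, all others fixed, that strictly decreases that job's cost. A potential game is one in which the better-response dynamic always converges. *)

(* Defs.v *)
From HB Require Import structures.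
From mathcomp Require Import all_boot all_order all_algebra.
Set Implicit Arguments.
Unset Strict Implicit.
Unset Printing Implicit Defensive.
Import Order.TTheory GRing.Theory Num.Theory.
Local Open Scope ring_scope.

(* Cost-minimization games with player set I and common strategy set S;
   c sigma i is the cost of player i in the profile sigma. *)

Definition better_response (R : realFieldType) (I : finType) (S : eqType)
    (c : {ffun I -> S} -> I -> R) (sigma tau : {ffun I -> S}) : Prop :=
  exists i : I,
    [/\ tau i != sigma i,
        forall i' : I, i' != i -> tau i' = sigma i'
      & c tau i < c sigma i].

Definition potential_game (R : realFieldType) (I : finType) (S : eqType)
    (c : {ffun I -> S} -> I -> R) : Prop :=
  forall sigma0 : {ffun I -> S},
    ~ exists s : nat -> {ffun I -> S},
        s 0%N = sigma0 /\ forall k : nat, better_response c (s k) (s k.+1).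

(* Expected completion time of job i when the jobs on its machine are processed
   in uniformly random order: each other job precedes i with probability 1/2. *)
Definition random_cost (R : realFieldType) (n m : nat) (p : 'I_n -> 'I_m -> R)
    (sigma : {ffun 'I_n -> 'I_m}) (i : 'I_n) : R :=
  p i (sigma i) +
  2%:R^-1 * \sum_(i' < n | (i' != i) && (sigma i' == sigma i)) p i' (sigma i).

(* Main.v *)
(* Let L_j be the load of machine j. A move of job i from machine j to machine k
   changes (L_0 - L_1)^2 + 3 \sum_i p_{i, sigma(i)}^2 by exactly 4 (p_ij + p_ik)
   times the change of the cost of i. So this is a weighted potential: it
   strictly decreases along better responses, and no profile can recur. *)
Require Import Defs.
From mathcomp Require Import all_boot all_order all_algebra.
From mathcomp Require Import ring.
Import Order.TTheory GRing.Theory Num.Theory.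
Local Open Scope ring_scope.

Set Implicit Arguments.
Unset Strict Implicit.
Unset Printing Implicit Defensive.

(** Along an infinite run [Phi] strictly decreases, so no profile recurs, although there are only
    finitely many. *)
Lemma potential_game_of_decreasing (R : realFieldType) (I S : finType)
    (c : {ffun I -> S} -> I -> R) (Phi : {ffun I -> S} -> R) :
  (forall sigma tau, better_response c sigma tau -> Phi tau < Phi sigma) ->
  potential_game c.
Proof.
move=> Phi_decr sigma0 [s [_ s_step]].
have Phi_lt : {homo Phi \o s : k l / (k < l)%N >-> l < k}.
  apply: homo_ltn => [x y z xy yz|k]; first exact: lt_trans yz xy.
  exact: Phi_decr.
have s_inj : injective s.
  move=> k l eq_s; have [kl|lk|//] := ltngtP k l.
    by have := Phi_lt _ _ kl; rewrite /= eq_s ltxx.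
  by have := Phi_lt _ _ lk; rewrite /= eq_s ltxx.
(* Pigeonhole: one more index than there are profiles. *)
have f_inj : injective (fun k : 'I_(#|{ffun I -> S}|.+1) => s k).
  by move=> k l /s_inj /val_inj.
by have := leq_card _ f_inj; rewrite card_ord ltnn.
Qed.

Definition load (R : realFieldType) (n m : nat) (p : 'I_n -> 'I_m -> R)
    (sigma : {ffun 'I_n -> 'I_m}) (j : 'I_m) : R :=
  \sum_(i < n | sigma i == j) p i j.

Definition random_potential (R : realFieldType) (n : nat) (p : 'I_n -> 'I_2 -> R)
    (sigma : {ffun 'I_n -> 'I_2}) : R :=
  (load p sigma 0 - load p sigma 1) ^+ 2 + 3 * \sum_i p i (sigma i) ^+ 2.

(** The square ignores the order of the machines, so one computation covers both directions of a
    move. *)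
Lemma sqr_sub_ord2 (R : realFieldType) (f : 'I_2 -> R) (j k : 'I_2) :
  j != k -> (f 0 - f 1) ^+ 2 = (f j - f k) ^+ 2.
Proof.
have ord2 (l : 'I_2) : l = 0 \/ l = 1.
  by case: l => [[|[|//]] lt_l2]; [left|right]; apply: val_inj.
by case: (ord2 j) => ->; case: (ord2 k) => -> // _; ring.
Qed.

(** Isolates job [i]: the remaining sum is unaffected by its moves and, for [j = sigma i], is the
    one in [random_cost]. *)
Lemma load_split (R : realFieldType) (n m : nat) (p : 'I_n -> 'I_m -> R)
    (sigma : {ffun 'I_n -> 'I_m}) (i : 'I_n) (j : 'I_m) :
  load p sigma j = (if sigma i == j then p i j else 0) +
    \sum_(i' < n | (i' != i) && (sigma i' == j)) p i' j.
Proof.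
rewrite /load big_mkcond (bigD1 i) //=; congr (_ + _).
by rewrite [RHS]big_mkcondr.
Qed.

(** Let A and B be the loads of the other jobs on j and k. The squared difference changes by (p_ij +
    p_ik) (2 (B - A) + p_ik - p_ij), the sum of squares by (p_ij + p_ik) (p_ik - p_ij). The factor 3
    raises the coefficient of p_ik - p_ij to 4, twice that of B - A, as in the cost. *)
Lemma random_potential_move (R : realFieldType) (n : nat)
    (p : 'I_n -> 'I_2 -> R) (sigma tau : {ffun 'I_n -> 'I_2}) (i : 'I_n) :
  tau i != sigma i -> (forall i', i' != i -> tau i' = sigma i') ->
  random_potential p tau - random_potential p sigma =
  4 * (p i (sigma i) + p i (tau i)) *
    (random_cost p tau i - random_cost p sigma i).
Proof.
move=> move_i fix_i'; set j := sigma i; set k := tau i.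
have jk : j != k by rewrite eq_sym.
rewrite /random_potential !(sqr_sub_ord2 _ jk) !(load_split _ _ i).
rewrite /random_cost -/j -/k !eqxx (negPf jk) eq_sym (negPf jk).
have others l : \sum_(i' < n | (i' != i) && (tau i' == l)) p i' l =
                \sum_(i' < n | (i' != i) && (sigma i' == l)) p i' l.
  by apply: eq_bigl => i'; case: eqVneq => //= /fix_i' ->.
have others_sqr : \sum_(i' < n | i' != i) p i' (tau i') ^+ 2 =
                  \sum_(i' < n | i' != i) p i' (sigma i') ^+ 2.
  by apply: eq_bigr => i' /fix_i' ->.
rewrite !others !(bigD1 (P := predT) i) //= others_sqr -/j -/k.
by field.
Qed.

Theorem theorem2 (R : realFieldType) (n : nat) (p : 'I_n -> 'I_2 -> R)
    (p_gt0 : forall (i : 'I_n) (j : 'I_2), 0 < p i j) :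
  potential_game (random_cost p).
Proof.
apply: (@potential_game_of_decreasing _ _ _ _ (random_potential p)).
move=> sigma tau [i [move_i fix_i' lt_cost]].
rewrite -subr_lt0 (random_potential_move _ move_i fix_i').
(* Positive processing times make the weight positive, so potential and cost change with the same
   sign. *)
by rewrite pmulr_rlt0 ?subr_lt0 // mulr_gt0 ?addr_gt0.
Qed.
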